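(* Let $B$ be a real $N\times N$ matrix such that $\sup_{t\in\mathbb{R}}\|\exp(-tB)\|<\infty$, and let $\mathscr{L}=\Delta+\langle Bx,\nabla\rangle-\partial_t$ on $\mathbb{R}^{N+1}=\mathbb{R}^N_x\times\mathbb{R}_t$. Let $u:\mathbb{R}^{N+1}\to\mathbb{R}$ be a bounded smooth solution to $\mathscr{L}u=0$ in $\mathbb{R}^{N+1}$. Then $u$ is constant.
   Context: $\Delta$, $\nabla$ and $\langle\cdot,\cdot\rangle$ are the Laplace operator, the gradient and the inner product in $\mathbb{R}^N$ (acting in the variable $x$), so $\mathscr{L}u(x,t)=\Delta_x u(x,t)+\langle Bx,\nabla_x u(x,t)\rangle-\partial_t u(x,t)$. $\|\cdot\|$ is the operator norm. Smooth means $C^\infty$. *)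

(* Defs.v *)
From HB Require Import structures.
From mathcomp Require Import all_boot all_order all_algebra.
From mathcomp Require Import all_classical all_reals all_analysis.

Set Implicit Arguments.
Unset Strict Implicit.
Unset Printing Implicit Defensive.

Import Order.TTheory GRing.Theory Num.Theory.
Import numFieldNormedType.Exports.

Local Open Scope classical_set_scope.
Local Open Scope ring_scope.

Definition dot (R : realType) (N : nat) (x y : 'cV[R]_N) : R :=
  \sum_(i < N) x i 0 * y i 0.

(* The library norm `|x| on 'cV[R]_N is the max norm, hence this definition. *)
Definition euclidean_norm (R : realType) (N : nat) (x : 'cV[R]_N) : R :=
  Num.sqrt (dot x x).

Definition operator_norm (R : realType) (N : nat) (A : 'M[R]_N) : R :=
  sup [set euclidean_norm (A *m x) | x in [set x | euclidean_norm x <= 1]].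

Definition expmx (R : realType) (N : nat) (A : 'M[R]_N) : 'M[R]_N :=
  limn (series (fun k : nat => (k`!%:R)^-1 *: A ^+ k)).

(* A point (x, t) of R^(N+1) is a pair in 'cV[R]_N * R. The standard basis is
   indexed by option 'I_N: Some i is the direction x_i and None is t. *)
Definition std_basis (R : realType) (N : nat) (j : option 'I_N) :
    'cV[R]_N * R :=
  if j is Some i then (delta_mx i 0, 0) else (0, 1).

Definition partial (R : realType) (N : nat) (j : option 'I_N)
    (u : 'cV[R]_N * R -> R) : 'cV[R]_N * R -> R :=
  fun z => 'D_(std_basis R j) u z.

Fixpoint Ck (R : realType) (N : nat) (k : nat) (u : 'cV[R]_N * R -> R) :
    Prop :=
  continuous u /\
  if k is k'.+1 then
    forall j : option 'I_N,
      (forall z, derivable u z (std_basis R j)) /\ Ck k' (partial j u)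
  else True.

Definition smooth (R : realType) (N : nat) (u : 'cV[R]_N * R -> R) : Prop :=
  forall k : nat, Ck k u.

Definition gradient_x (R : realType) (N : nat) (u : 'cV[R]_N * R -> R)
    (z : 'cV[R]_N * R) : 'cV[R]_N :=
  \col_(i < N) partial (Some i) u z.

Definition laplacian_x (R : realType) (N : nat) (u : 'cV[R]_N * R -> R)
    (z : 'cV[R]_N * R) : R :=
  \sum_(i < N) partial (Some i) (partial (Some i) u) z.

Definition evolution_op (R : realType) (N : nat) (B : 'M[R]_N)
    (u : 'cV[R]_N * R -> R) (z : 'cV[R]_N * R) : R :=
  laplacian_x u z + dot (B *m z.1) (gradient_x u z) - partial None u z.

(* Main.v *)
Require Import Defs.
From HB Require Import structures.
From mathcomp Require Import all_boot all_order all_algebra.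
From mathcomp Require Import all_classical all_reals all_analysis.
From mathcomp Require Import ring lra.

Set Implicit Arguments.
Unset Strict Implicit.
Unset Printing Implicit Defensive.

Import Order.TTheory GRing.Theory Num.Theory.
Import numFieldNormedType.Exports.

Local Open Scope classical_set_scope.
Local Open Scope ring_scope.

(** The proof is a Bernstein gradient estimate on large space-time regions.
    Write E(t) = exp(tB) and L for the evolution operator.  The hypothesis says
    that E is bounded on the whole real line, so x and y = E(t)x have
    comparable lengths, uniformly in t.  In the coordinates (y, t) the drift
    disappears, so L behaves like a heat operator; instead of changing
    variables, the proof uses functions of (x, t) that absorb the drift:
    - each coordinate y_k satisfies L y_k = 0 ([evolution_op_flow_coord]), so
      S = |y|^2 satisfies L S = 2 |E(t)|^2 in the Frobenius norm, which is
      bounded;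
    - for a fixed vector e, the derivative w of u in the moving direction
      E(-t)e satisfies L w = 0 ([evolution_op_transported_derivative]): the
      motion of the direction cancels the commutator of the drift with the
      gradient.

    Fix a time t0 and r > 0 and let g = r - (t0 - t) - S.  The region g >= 0,
    t <= t0 is compact, by boundedness of the flow.  On it, consider
    F = g^2 w^2 + lam u^2.  The product rule gives
      L F >= 2 g w^2 L g - 6 w^2 |grad g|^2 + 2 lam |grad u|^2.
    There L g is bounded below, |grad g|^2 = O(r), g <= r and
    w^2 = O(|grad u|^2), so a suitable lam = O(r) makes L F > 0 wherever w is
    nonzero.  By the weak maximum principle F <= lam sup u^2: at the maximum
    either g = 0, or w = 0, or L F > 0, and the last is impossible.
    At a given point of time t0, g >= r / 2 for r large, hence
    r^2 w^2 / 4 <= lam sup u^2 = O(r); letting r tend to infinity gives w = 0.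
    As e is arbitrary, the spatial gradient vanishes identically, the equation
    then gives that the time derivative vanishes, and u is constant. *)

(** * Differentiation along a line *)

Section LineCalculus.
Variables (R : realType) (V : normedModType R).
Implicit Types (f : V -> R) (z v w : V) (s : R).

Lemma is_derive_line f z v s d :
  is_derive (s *: v + z) v f d ->
  is_derive s 1 (fun r : R => f (r *: v + z)) d.
Proof.
set g1 := fun r : R => _.
have E : (fun h : R => h^-1 *: ((g1 \o shift s) (h *: 1) - g1 s)) =
         (fun h : R => h^-1 *: ((f \o shift (s *: v + z)) (h *: v)
                                 - f (s *: v + z))).
  apply/funext => h; rewrite /g1 /=.
  by rewrite -[h *: 1]/(h * 1) mulr1 scalerDl addrA.
by case=> df dE; split; [rewrite /derivable E|rewrite /derive E].
Qed.

Lemma line_is_derive f z v d :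
  is_derive (0 : R) 1 (fun r : R => f (r *: v + z)) d -> is_derive z v f d.
Proof.
set g1 := fun r : R => _.
have E : (fun h : R => h^-1 *: ((g1 \o shift 0) (h *: 1) - g1 0)) =
         (fun h : R => h^-1 *: ((f \o shift z) (h *: v) - f z)).
  apply/funext => h; rewrite /g1 /=.
  by rewrite -[h *: 1]/(h * 1) mulr1 addr0 scale0r add0r.
by case=> df dE; split; [rewrite /derivable -E|rewrite /derive -E].
Qed.

Lemma MVT_line f f1 z v (h : R) : 0 < h ->
  (forall y, is_derive y v f (f1 y)) ->
  exists2 s, 0 < s < h & f (h *: v + z) - f z = h * f1 (s *: v + z).
Proof.
move=> h0 df.
have dl s : is_derive s 1 (fun r : R => f (r *: v + z)) (f1 (s *: v + z)).
  by apply: is_derive_line; exact: df.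
have [|s sh] := @MVT R _ (fun s => f1 (s *: v + z)) 0 h h0 (fun s _ => dl s).
- apply: continuous_subspaceT => s.
  by apply/differentiable_continuous/derivable1_diffP; case: (dl s).
- rewrite /= scale0r add0r subr0 mulrC => E; exists s => //.
Qed.

Lemma derive_eq0_line f z v s :
  (forall y, is_derive y v f 0) -> f (s *: v + z) = f z.
Proof.
move=> df; have main (r : R) (y : V) : 0 < r -> f (r *: v + y) = f y.
  move=> r0; have [q _] := MVT_line y r0 df.
  by rewrite mulr0 => /eqP; rewrite subr_eq0 => /eqP.
have [s0|s0|->] := ltgtP s 0; last by rewrite scale0r add0r.
- have := main (- s) (s *: v + z); rewrite oppr_gt0 s0 => /(_ isT) <-.
  by rewrite addrA -scalerDl addNr scale0r add0r.
- exact: main.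
Qed.

Lemma derive_gt0_near f z v d : is_derive z v f d -> 0 < d ->
  \forall s \near (0 : R), (0 < s -> f z < f (s *: v + z)) /\
                           (s < 0 -> f (s *: v + z) < f z).
Proof.
case=> df dE d0.
have /cvgr_gt : h^-1 *: ((f \o shift z) (h *: v) - f z) @[h --> 0^'] --> d.
  by rewrite -dE; exact: df.
move=> /(_ _ d0); rewrite near_withinE; apply: filterS => s /= sP.
split=> s0.
- have := sP (lt0r_neq0 s0).
  by rewrite -[_ *: _]/(_ * _) pmulr_rgt0 ?invr_gt0// subr_gt0.
- have := sP (ltr0_neq0 s0).
  by rewrite -[_ *: _]/(_ * _) nmulr_rgt0 ?invr_lt0// subr_lt0.
Qed.

(** At a maximum over a time interval closed on the right, only past values can be
    compared with [f z]. *)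
Lemma derive_ge0_left f z v d : is_derive z v f d ->
  (\forall s \near (0 : R), s < 0 -> f (s *: v + z) <= f z) -> 0 <= d.
Proof.
move=> df fle; rewrite leNgt; apply/negP => d0.
have dN : is_derive z v (- f) (- d) by exact: is_deriveN.
have /nbhs_ballP[e /= e0 eP] : \forall s \near (0 : R),
    (s < 0 -> f (s *: v + z) <= f z) /\ (s < 0 -> f z < f (s *: v + z)).
  near=> s; split; first by near: s.
  have [_] : (0 < s -> (- f) z < (- f) (s *: v + z)) /\
             (s < 0 -> (- f) (s *: v + z) < (- f) z).
    by near: s; apply: derive_gt0_near dN _; rewrite oppr_gt0.
  by move=> + s0 => /(_ s0); rewrite ltrN2.
have [|h1 h2] := eP (- (e / 2)).
  by rewrite /ball/= sub0r opprK gtr0_norm ?divr_gt0//; lra.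
have eN : - (e / 2) < 0 by lra.
by have := h2 eN; rewrite ltNge h1.
Unshelve. all: by end_near. Qed.

Lemma derive_eq0_max f z v d : is_derive z v f d ->
  (\forall s \near (0 : R), f (s *: v + z) <= f z) -> d = 0.
Proof.
move=> df fle; apply/eqP; rewrite eq_le; apply/andP; split.
- rewrite leNgt; apply/negP => d0.
  have /nbhs_ballP[e /= e0 eP] : \forall s \near (0 : R),
      f (s *: v + z) <= f z /\ (0 < s -> f z < f (s *: v + z)).
    near=> s; split; first by near: s.
    have [] : (0 < s -> f z < f (s *: v + z)) /\
              (s < 0 -> f (s *: v + z) < f z) by near: s; exact: derive_gt0_near.
    by [].
  have [|h1 h2] := eP (e / 2).
    by rewrite /ball/= sub0r normrN gtr0_norm ?divr_gt0//; lra.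
  have /h2 : 0 < e / 2 by lra.
  by rewrite ltNge h1.
- by apply: derive_ge0_left df _; apply: filterS fle.
Unshelve. all: by end_near. Qed.

(** If the second derivative were positive, the first derivative, which vanishes
    at the maximum, would be positive just after it, and the mean value theorem
    would produce larger values of [f]. *)
Lemma derive2_le0_max f f1 z v d : (forall y, is_derive y v f (f1 y)) ->
  is_derive z v f1 d ->
  (\forall s \near (0 : R), f (s *: v + z) <= f z) -> d <= 0.
Proof.
move=> df df1 fle; rewrite leNgt; apply/negP => d0.
have f1z : f1 z = 0 by apply: derive_eq0_max (df z) fle.
have /nbhs_ballP[e /= e0 eP] : \forall s \near (0 : R),
    f (s *: v + z) <= f z /\ (0 < s -> f1 z < f1 (s *: v + z)).
  near=> s; split; first by near: s.
  have [] : (0 < s -> f1 z < f1 (s *: v + z)) /\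
            (s < 0 -> f1 (s *: v + z) < f1 z) by near: s; exact: derive_gt0_near.
  by [].
have h0 : 0 < e / 2 by lra.
have [s /andP[s0 sh] E] := MVT_line z h0 df.
have [|h1 _] := eP (e / 2).
  by rewrite /ball/= sub0r normrN gtr0_norm//; lra.
have [|_ /(_ s0)] := eP s.
  by rewrite /ball/= sub0r normrN gtr0_norm//; lra.
rewrite f1z => f1s; have : 0 < f ((e / 2) *: v + z) - f z by rewrite E mulr_gt0.
by rewrite subr_gt0 ltNge h1.
Unshelve. all: by end_near. Qed.

(** The mixed difference of [f] over a rectangle is the increment over one side
    of an increment along the other: two mean value theorems express it by
    the mixed derivative. *)
Lemma rectangle_MVT f fv fvw z v w (h k : R) : 0 < h -> 0 < k ->
  (forall y, is_derive y v f (fv y)) -> (forall y, is_derive y w fv (fvw y)) ->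
  exists s r, [/\ 0 < s < h, 0 < r < k &
    f (h *: v + (k *: w + z)) - f (k *: w + z) - (f (h *: v + z) - f z) =
    h * (k * fvw (r *: w + (s *: v + z)))].
Proof.
move=> h0 k0 df dfv.
have dg y : is_derive y v (fun y => f (k *: w + y) - f y)
                          (fv (k *: w + y) - fv y).
  apply: is_deriveB; apply: line_is_derive.
  have -> : (fun r : R => f (k *: w + (r *: v + y))) =
            (fun r : R => f (r *: v + (k *: w + y))).
    by apply/funext => r; rewrite addrCA.
  apply: is_derive_line; rewrite scale0r add0r; exact: df.
have [s sh E] := MVT_line z h0 dg.
have [r rk E'] := MVT_line (s *: v + z) k0 dfv.
exists s, r; split=> //; rewrite -E' -E addrCA; ring.
Qed.

(** Schwarz's theorem: the mixed difference over a small square does not depend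
    on the order of the directions, and by [rectangle_MVT] it is the area times
    either mixed derivative at nearby points. *)
Lemma derive_comm f fv fw fvw fwv z v w :
  (forall y, is_derive y v f (fv y)) -> (forall y, is_derive y w f (fw y)) ->
  (forall y, is_derive y w fv (fvw y)) ->
  (forall y, is_derive y v fw (fwv y)) ->
  {for z, continuous fvw} -> {for z, continuous fwv} -> fvw z = fwv z.
Proof.
move=> dv dw dvw dwv cvw cwv.
have close (g : V -> R) (a b : V) (e : R) : {for z, continuous g} -> 0 < e ->
    \forall h \near (0 : R), forall s r, 0 < s < h -> 0 < r < h ->
      `|g z - g (r *: a + (s *: b + z))| < e.
  move=> /cvgrPdist_lt /[apply] /nbhs_ballP[d /= d0 dP].
  have ab : 0 < `|a| + `|b| + 1 by rewrite ltr_wpDl ?addr_ge0.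
  near=> h => s r /andP[s0 sh] /andP[r0 rh]; apply: dP.
  have hd : h * (`|a| + `|b| + 1) < d.
    rewrite -ltr_pdivlMr//; near: h.
    exists (d / (`|a| + `|b| + 1)) => /=; first exact: divr_gt0.
    by move=> h; rewrite /= sub0r normrN => /ltr_normlW.
  rewrite -ball_normE /= addrA opprD addrCA subrr addr0 normrN.
  apply: le_lt_trans hd; rewrite (le_trans (ler_normD _ _))// !normrZ.
  rewrite (gtr0_norm s0) (gtr0_norm r0) mulrDr mulrDr mulr1.
  rewrite -[leLHS]addr0 !lerD//; last exact: ltW (lt_trans s0 sh).
  - by rewrite ler_wpM2r// ltW.
  - by rewrite ler_wpM2r// ltW.
apply/eqP; rewrite -subr_eq0 -normr_le0; apply/ler_addgt0Pl => e e0.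
rewrite addr0; have e20 : 0 < e / 2 by lra.
have /nbhs_ballP[d /= d0 dP] : \forall h \near (0 : R),
    (forall s r, 0 < s < h -> 0 < r < h ->
      `|fvw z - fvw (r *: w + (s *: v + z))| < e / 2) /\
    (forall s r, 0 < s < h -> 0 < r < h ->
      `|fwv z - fwv (r *: v + (s *: w + z))| < e / 2).
  by apply: filterI; exact: close.
have h0 : 0 < d / 2 by lra.
have [|c1 c2] := dP (d / 2).
  by rewrite /ball/= sub0r normrN gtr0_norm//; lra.
have [s [r [sh rh E]]] := rectangle_MVT z h0 h0 dv dvw.
have [s' [r' [sh' rh' E']]] := rectangle_MVT z h0 h0 dw dwv.
have {E'} : fvw (r *: w + (s *: v + z)) = fwv (r' *: v + (s' *: w + z)).
  apply: (mulfI (lt0r_neq0 h0)); apply: (mulfI (lt0r_neq0 h0)).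
  by rewrite -E -E' [in RHS]addrCA; ring.
move=> E'; have := c1 _ _ sh rh; have := c2 _ _ sh' rh'.
rewrite E' => l1 l2; rewrite ltW//.
have -> : fvw z - fwv z = (fvw z - fwv (r' *: v + (s' *: w + z))) -
   (fwv z - fwv (r' *: v + (s' *: w + z))) by ring.
by rewrite (le_lt_trans (ler_normB _ _))//; lra.
Unshelve. all: by end_near. Qed.
End LineCalculus.

(** * The matrix exponential *)

Lemma scale_regE (R : realType) (a b : R) : a *: b = a * b.
Proof. by []. Qed.

Lemma cvg_mx_entries (R : realType) m n T (F : set_system T) (u : T -> 'M[R]_(m, n))
    (M : 'M[R]_(m, n)) : Filter F ->
  (forall i j, (fun x => u x i j) @ F --> M i j) -> u @ F --> M.
Proof.
move=> FF uM; apply/cvgrPdist_lt => e e0.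
near=> x; rewrite [ltLHS]/Num.Def.normr/= mx_normrE.
apply/bigmax_ltP; split=> // -[i j] _; rewrite !mxE/=.
move: (i) (j); near: x.
apply: filter_forall => k; apply: filter_forall => l.
by move: (uM k l) => /cvgrPdist_lt/(_ _ e0).
Unshelve. all: by end_near. Qed.

Section MatrixExponential.
Variables (R : realType) (N : nat).
Implicit Types A B M : 'M[R]_N.

(** Each entry of [M *m expmx (t *: A)] is a power series in [t] with these
    coefficients.  The left factor [M] makes the family stable under termwise
    differentiation, which replaces [M] by [M *m A]. *)
Let coef A M i j (k : nat) : R := (M *m A ^+ k) i j * (k`!%:R)^-1.

Let row_sum_le M i : \sum_j `|M i j| <= \sum_i \sum_j `|M i j|.
Proof. by rewrite [leRHS](bigD1 i)//= lerDl; do 2!apply: sumr_ge0 => ? _. Qed.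

Let total_ge0 M : 0 <= \sum_i \sum_j `|M i j|.
Proof. by do 2!apply: sumr_ge0 => ? _. Qed.

Let row_sumM A M i : \sum_j `|(M *m A) i j| <=
  (\sum_j `|M i j|) * (\sum_i \sum_j `|A i j|).
Proof.
apply: (@le_trans _ _ (\sum_j \sum_k `|M i k| * `|A k j|)).
  apply: ler_sum => j _; rewrite mxE (le_trans (ler_norm_sum _ _ _))//.
  by apply: ler_sum => k _; rewrite normrM.
rewrite exchange_big/= mulr_suml; apply: ler_sum => k _.
by rewrite -mulr_sumr ler_wpM2l.
Qed.

Let coef_le A M i j k :
  `|coef A M i j k| <= (\sum_j `|M i j|) * ((\sum_i \sum_j `|A i j|) ^+ k / k`!%:R).
Proof.
rewrite /coef normrM [`|_^-1|]ger0_norm ?invr_ge0// mulrA ler_wpM2r ?invr_ge0//.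
apply: (@le_trans _ _ (\sum_j `|(M *m A ^+ k) i j|)).
  by rewrite (bigD1 j)//= lerDl sumr_ge0.
elim: k => [|k ih]; first by rewrite expr0 mulmx1 expr0 mulr1.
rewrite !exprSr -mulmxE mulmxA (le_trans (row_sumM _ _ _))//.
by rewrite mulrA ler_wpM2r.
Qed.

Let cvg_coef A M i j x : cvgn (pseries (coef A M i j) x).
Proof.
apply: normed_cvg.
apply: (@series_le_cvg _ _ (fun k => (\sum_j `|M i j|) *
  exp_coeff ((\sum_i \sum_j `|A i j|) * `|x|) k)).
- by move=> n /=.
- by move=> n; rewrite mulr_ge0 ?sumr_ge0// exp_coeff_ge0// mulr_ge0.
- move=> n /=; rewrite normrM normrX /exp_coeff/= exprMn mulrAC mulrA.
  by rewrite ler_wpM2r ?exprn_ge0//; exact: coef_le.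
- exact/is_cvg_seriesZ/is_cvg_series_exp_coeff.
Qed.

Let coef_diffs A M i j : pseries_diffs (coef A M i j) = coef A (M *m A) i j.
Proof.
apply/funext => k; rewrite /pseries_diffs /coef exprS -mulmxE mulmxA factS natrM.
by rewrite invfM mulrCA [_%:R * _]mulrA divff ?mul1r// pnatr_eq0.
Qed.

Lemma cvg_expmx A : series (fun k : nat => (k`!%:R)^-1 *: A ^+ k) @ \oo --> expmx A.
Proof.
apply/cvg_ex; exists (\matrix_(i, j) limn (pseries (coef A 1%:M i j) 1)).
apply: cvg_mx_entries => i j; rewrite mxE.
rewrite [X in X @ \oo --> _](_ : _ = pseries (coef A 1%:M i j) 1).
  exact: cvg_coef.
apply/funext => n; rewrite /pseries /series/= summxE.
by apply: eq_bigr => k _; rewrite mxE /coef mul1mx expr1n mulr1 mulrC.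
Qed.

Lemma cvg_expmx_entry A i j :
  (fun n => series (fun k : nat => (k`!%:R)^-1 *: A ^+ k) n i j) @ \oo --> expmx A i j.
Proof.
have := @cvg_comp _ _ _ _ (fun M : 'M[R]_N => M i j) _ _ _ (@cvg_expmx A)
  (@coord_continuous R N N i j _).
exact.
Qed.

Let exprZmx A t k : (t *: A) ^+ k = t ^+ k *: A ^+ k.
Proof.
elim: k => [|k ih]; first by rewrite !expr0 scale1r.
by rewrite !exprS ih -!mulmxE -scalemxAl -scalemxAr scalerA.
Qed.

Lemma expmx_entry A M i j t :
  (M *m expmx (t *: A)) i j = limn (pseries (coef A M i j) t).
Proof.
have cM : (fun n => (M *m series (fun k : nat => (k`!%:R)^-1 *: (t *: A) ^+ k) n) i j)
    @ \oo --> (M *m expmx (t *: A)) i j.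
  under eq_fun do rewrite mxE; rewrite mxE.
  apply: cvg_big => [|k _]; first exact: add_continuous.
  apply: cvgM; first exact: cvg_cst.
  exact: cvg_expmx_entry.
apply/esym/cvg_lim => //.
rewrite [X in X @ _ --> _](_ : _ = (fun n => (M *m
  series (fun k : nat => (k`!%:R)^-1 *: (t *: A) ^+ k) n) i j)) //.
apply/funext => n; rewrite /series/= mulmx_sumr summxE /pseries /series/=.
apply: eq_bigr => k _; rewrite -scalemxAr exprZmx -scalemxAr !mxE /coef !mxE.
ring.
Qed.

Lemma is_derive_expmx A M i j (t : R) :
  is_derive t 1 (fun t : R => (M *m expmx (t *: A)) i j)
    ((M *m A *m expmx (t *: A)) i j).
Proof.
under eq_fun do rewrite expmx_entry.
rewrite expmx_entry -coef_diffs.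
apply: (@pseries_snd_diffs _ _ (`|t| + 1)).
- exact: cvg_coef.
- by rewrite coef_diffs; exact: cvg_coef.
- by rewrite !coef_diffs; exact: cvg_coef.
- by rewrite [ltRHS]ger0_norm ?addr_ge0// ltrDl.
Qed.

Lemma expmx_comm A t : A *m expmx (t *: A) = expmx (t *: A) *m A.
Proof.
have cA i j : (fun n => (A *m series (fun k : nat => (k`!%:R)^-1 *: (t *: A) ^+ k) n) i j)
    @ \oo --> (A *m expmx (t *: A)) i j.
  under eq_fun do rewrite mxE; rewrite mxE.
  apply: cvg_big => [|k _]; first exact: add_continuous.
  apply: cvgM; first exact: cvg_cst.
  exact: cvg_expmx_entry.
have cA' i j :
    (fun n => (series (fun k : nat => (k`!%:R)^-1 *: (t *: A) ^+ k) n *m A) i j)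
    @ \oo --> (expmx (t *: A) *m A) i j.
  under eq_fun do rewrite mxE; rewrite mxE.
  apply: cvg_big => [|k _]; first exact: add_continuous.
  apply: cvgM; last exact: cvg_cst.
  exact: cvg_expmx_entry.
apply/matrixP => i j.
suff E : (fun n => (A *m series (fun k : nat => (k`!%:R)^-1 *: (t *: A) ^+ k) n) i j) =
  (fun n => (series (fun k : nat => (k`!%:R)^-1 *: (t *: A) ^+ k) n *m A) i j).
  rewrite -(cvg_lim (@Rhausdorff R) (cA i j)) E.
  exact: cvg_lim (cA' i j).
apply/funext => n; congr (fun_of_matrix _ i j).
rewrite /series/= mulmx_sumr mulmx_suml; apply: eq_bigr => k _.
rewrite -scalemxAl -scalemxAr; congr (_ *: _).
rewrite exprZmx -scalemxAl -scalemxAr; congr (_ *: _).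
by rewrite !mulmxE -exprS -exprSr.
Qed.

Lemma expmx0 : expmx (0 : 'M[R]_N) = 1%:M.
Proof.
apply/matrixP => i j.
rewrite -(cvg_lim (@Rhausdorff R) (@cvg_expmx_entry 0 i j)).
apply: cvg_lim => //.
apply: (@cvg_near_cst _ _ _ _ _ _ _); exists 1%N => // n /= n0.
rewrite /series/= -(prednK n0) big_nat_recl//= fact0 invr1 scale1r expr0.
by rewrite big1 ?addr0// => k _; rewrite expr0n /= scaler0.
Qed.

(** The product has zero derivative and equals the identity at [t = 0]. *)
Lemma expmxMN A t : expmx (t *: A) *m expmx (- t *: A) = 1%:M.
Proof.
have dE i j (s : R) : is_derive s 1 (fun t : R => (expmx (t *: A)) i j)
    ((A *m expmx (s *: A)) i j).
  have := is_derive_expmx A 1%:M i j s.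
  by under eq_fun do rewrite mul1mx; rewrite mul1mx.
have dEN i j (s : R) : is_derive s 1 (fun t : R => (expmx (- t *: A)) i j)
    (- (A *m expmx (- s *: A)) i j).
  have := is_derive_expmx (- A) 1%:M i j s.
  under eq_fun do rewrite mul1mx scalerN -scaleNr.
  by rewrite mul1mx scalerN -scaleNr mulNmx [in X in is_derive _ _ _ X -> _]mxE.
apply/matrixP => i j.
have d0 (s : R^o) :
    is_derive s 1 (fun t : R => (expmx (t *: A) *m expmx (- t *: A)) i j) 0.
  have -> : (fun t : R => (expmx (t *: A) *m expmx (- t *: A)) i j) =
     \sum_k ((fun t : R => (expmx (t *: A)) i k) * (fun t : R => (expmx (- t *: A)) k j)).
    by apply/funext => r; rewrite mxE fct_sumE.
  apply: is_derive_eq.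
  transitivity ((A *m expmx (s *: A) *m expmx (- s *: A)) i j -
                (expmx (s *: A) *m (A *m expmx (- s *: A))) i j).
    rewrite [X in _ = X - _]mxE [X in _ = _ - X]mxE -sumrB.
    apply: eq_bigr => k _ /=.
    by rewrite -[_ *: - _]/(_ * - _) -[X in _ + X]/(_ * _) mulrN addrC mulrC.
  by rewrite (expmx_comm A s) mulmxA subrr.
have := @derive_eq0_line R R^o _ 0 1 t d0.
rewrite addr0 (_ : t *: 1 = t); last exact: mulr1.
move=> ->.
by rewrite scale0r oppr0 scale0r expmx0 mul1mx.
Qed.

End MatrixExponential.

(** * Boundedness of the flow *)

Section OperatorNorm.
Variables (R : realType) (N : nat).
Implicit Types (A : 'M[R]_N) (x : 'cV[R]_N).

Lemma entry_le_euclidean x i : `|x i 0| <= euclidean_norm x.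
Proof.
rewrite -(@sqrtr_sqr _ (x i 0)) /euclidean_norm ler_wsqrtr//.
rewrite /dot (bigD1 i)//= expr2 lerDl sumr_ge0// => j _.
by rewrite -expr2 sqr_ge0.
Qed.

(** Evaluate at the basis vector [delta_mx j 0]; the supremum defining the norm
    is over a bounded set, which is where the row sums enter. *)
Lemma entry_le_operator_norm A i j : `|A i j| <= operator_norm A.
Proof.
have -> : A i j = (A *m (delta_mx j 0 : 'cV_N)) i 0.
  by rewrite -colE mxE.
apply: le_trans (entry_le_euclidean _ i) _.
apply: ub_le_sup; last first.
  exists (delta_mx j 0) => //=.
  rewrite /euclidean_norm /dot (bigD1 j)//= big1 ?addr0.
    by rewrite !mxE !eqxx mulr1 sqrtr1.
  by move=> k kj; rewrite !mxE (negbTE kj) mul0r.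
exists (Num.sqrt (\sum_i (\sum_j `|A i j|) ^+ 2)) => _ [x /= x1 <-].
rewrite /euclidean_norm ler_wsqrtr// /dot; apply: ler_sum => k _.
rewrite -expr2 -real_normK ?num_real// lerXn2r// ?nnegrE ?sumr_ge0//.
rewrite mxE (le_trans (ler_norm_sum _ _ _))//; apply: ler_sum => l _.
by rewrite normrM ler_piMr// (le_trans (entry_le_euclidean _ _)).
Qed.

Lemma expmx_entry_bounded (B : 'M[R]_N) :
  (ereal_sup (range (fun t : R => (operator_norm (expmx (- t *: B)))%:E))
    < +oo)%E ->
  exists2 K, 0 < K & forall t i j, `|expmx (t *: B) i j| <= K.
Proof.
move=> hB; set s := ereal_sup _ in hB.
have le_s t : ((operator_norm (expmx (t *: B)))%:E <= s)%E.
  rewrite -[t]opprK; apply: ereal_sup_ubound.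
  by exists (- t).
have [K sK] : exists K : R, s = K%:E.
  move: (le_s 0) hB; case: (s) => [K|//|//] _ _.
  by exists K.
exists (`|K| + 1) => [|t i j]; first exact: ltr_wpDl.
rewrite (le_trans (entry_le_operator_norm _ _ _))//.
have := le_s t; rewrite sK lee_fin => /le_trans; apply.
by rewrite (le_trans (ler_norm _))// lerDl.
Qed.

End OperatorNorm.

(** * Functions of parabolic regularity *)

Section ParabolicFunctions.
Variables (R : realType) (N : nat).
Local Notation V := ('cV[R]_N * R)%type.
Implicit Types (u f g : V -> R) (a : R -> R) (z : V) (i : 'I_N).

(** The first derivatives and the pure second derivatives in space are all that the
    operator and the maximum principle see. *)
Definition C21 f : Prop :=
  [/\ continuous f,
      forall j z, derivable f z (std_basis R j)
    & forall i z, derivable (partial (Some i) f) z (std_basis R (Some i))].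

Lemma partialE j f d : (forall z, is_derive z (std_basis R j) f (d z)) ->
  partial j f = d.
Proof. by move=> fd; apply/funext => z; rewrite /partial; have [] := fd z. Qed.

Lemma C21_is_derive f j z : C21 f ->
  is_derive z (std_basis R j) f (partial j f z).
Proof. by case=> _ df _; exact/derivableP. Qed.

Lemma C21_is_derive2 f i z : C21 f ->
  is_derive z (std_basis R (Some i)) (partial (Some i) f)
    (partial (Some i) (partial (Some i) f) z).
Proof. by case=> _ _ df; exact/derivableP. Qed.

Lemma C21_intro f (d : option 'I_N -> V -> R) (d2 : 'I_N -> V -> R) :
  continuous f ->
  (forall j z, is_derive z (std_basis R j) f (d j z)) ->
  (forall i z, is_derive z (std_basis R (Some i)) (d (Some i)) (d2 i z)) ->
  C21 f.
Proof.
move=> cf df d2f; split=> // i z.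
by rewrite (partialE (df (Some i))); case: (d2f i z).
Qed.

Lemma partialD j f g : C21 f -> C21 g ->
  partial j (f + g) = partial j f + partial j g.
Proof.
move=> cf cg; apply: partialE => z.
by apply: is_deriveD; exact: C21_is_derive.
Qed.

Lemma partialM j f g : C21 f -> C21 g ->
  partial j (f * g) = f * partial j g + g * partial j f.
Proof.
move=> cf cg; apply: partialE => z.
by apply: is_deriveM; exact: C21_is_derive.
Qed.

Let is_derive2M i f g z : C21 f -> C21 g ->
  is_derive z (std_basis R (Some i))
    (f * partial (Some i) g + g * partial (Some i) f)
    (f z * partial (Some i) (partial (Some i) g) z +
     g z * partial (Some i) (partial (Some i) f) z +
     partial (Some i) f z * partial (Some i) g z *+ 2).
Proof.
move=> cf cg.
have df := C21_is_derive (Some i) z cf; have dg := C21_is_derive (Some i) z cg.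
have df2 := C21_is_derive2 i z cf; have dg2 := C21_is_derive2 i z cg.
apply: is_derive_eq (is_deriveD (is_deriveM df dg2) (is_deriveM dg df2)) _.
rewrite !scale_regE; move: (partial _ _ _) (partial _ _ z) (partial _ _ z) => a b c.
ring.
Qed.

Lemma C21D f g : C21 f -> C21 g -> C21 (f + g).
Proof.
move=> cf cg.
apply: (@C21_intro _ (fun j z => partial j f z + partial j g z)
  (fun i z => partial (Some i) (partial (Some i) f) z +
              partial (Some i) (partial (Some i) g) z)).
- by case: cf => cf _ _; case: cg => cg _ _ z; exact: (continuousD (cf z) (cg z)).
- by move=> j z; apply: is_deriveD; exact: C21_is_derive.
- by move=> i z; apply: is_deriveD; exact: C21_is_derive2.
Qed.

Lemma C21M f g : C21 f -> C21 g -> C21 (f * g).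
Proof.
move=> cf cg.
apply: (@C21_intro _ (fun j z => f z * partial j g z + g z * partial j f z) _).
- by case: cf => cf _ _; case: cg => cg _ _ z; exact: (continuousM (cf z) (cg z)).
- by move=> j z; apply: is_deriveM; exact: C21_is_derive.
- by move=> i z; exact: is_derive2M.
Qed.

Lemma C21_cst (c : R) : C21 (cst c).
Proof.
apply: (@C21_intro _ (fun _ _ => 0) (fun _ _ => 0)).
by move=> z; exact: cvg_cst.
Qed.

Lemma C21_sum n (f : 'I_n -> V -> R) :
  (forall k, C21 (f k)) -> C21 (\sum_k f k).
Proof.
move=> cf; apply: (big_ind C21); [exact: (C21_cst 0)|exact: C21D|].
by move=> k _; exact: cf.
Qed.

Lemma partial_cst j c : partial j (cst c : V -> R) = 0.
Proof. by apply: partialE => z; exact: is_derive_cst. Qed.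

Lemma is_derive_time a j z (d : R) : is_derive z.2 1 a d ->
  is_derive z (std_basis R j) (a \o snd) (if j is Some _ then 0 else d).
Proof.
case: j => [i|] da; apply: line_is_derive => /=.
- under eq_fun do rewrite scaler0 add0r; exact: is_derive_cst.
- by apply: (@is_derive_line _ R^o); rewrite scale0r add0r.
Qed.

Lemma is_derive_coord l j z :
  is_derive z (std_basis R j) (fun z : V => z.1 l 0)
    (if j is Some i then (i == l)%:R else 0).
Proof.
apply: line_is_derive; case: j => [i|] /=.
- set c : R := _%:R.
  have -> : (fun r : R => (r *: delta_mx i 0 + z.1) l 0) =
            (id : R -> R) * cst c + cst (z.1 l 0).
    by apply/funext => r; rewrite !mxE eqxx andbT eq_sym.
  apply: is_derive_eq; rewrite scaler0 add0r addr0.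
  exact: mulr1.
- under eq_fun do rewrite scaler0 add0r; exact: is_derive_cst.
Qed.

Lemma C21_coord l : C21 (fun z : V => z.1 l 0).
Proof.
apply: (@C21_intro _ (fun j _ => if j is Some i then (i == l)%:R else 0)
  (fun _ _ => 0)).
- move=> z; apply: (@continuous_comp _ _ _ fst (fun x : 'cV[R]_N => x l 0)).
    exact: cvg_fst.
  exact: coord_continuous.
- by move=> j z; exact: is_derive_coord.
Qed.

Lemma C21_time a d : (forall t : R, is_derive t 1 a (d t)) ->
  C21 (a \o snd : V -> R).
Proof.
move=> da.
apply: (@C21_intro _ (fun j z => if j is Some _ then 0 else d z.2)
  (fun _ _ => 0)).
- move=> z; apply: continuous_comp; first exact: cvg_snd.
  by apply/differentiable_continuous/derivable1_diffP; case: (da z.2).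
- by move=> j z; apply: is_derive_time.
- by move=> i z; exact: is_derive_cst.
Qed.

Lemma partial_time j a d : (forall t : R, is_derive t 1 a (d t)) ->
  partial j (a \o snd : V -> R) = fun z => if j is Some _ then 0 else d z.2.
Proof. by move=> da; apply: partialE => z; exact: is_derive_time. Qed.

Lemma partial_coord j l : partial j (fun z : V => z.1 l 0) =
  cst (if j is Some i then (i == l)%:R else 0).
Proof. by apply: partialE => z; exact: is_derive_coord. Qed.

Variable B : 'M[R]_N.
Local Notation L := (evolution_op B).

Lemma evolution_op_cst c z : L (cst c) z = 0.
Proof.
have p0 j : partial j (fun _ : V => 0 : R) = 0 := partial_cst j 0.
rewrite /evolution_op /laplacian_x partial_cst subr0 /dot /gradient_x.
rewrite big1 ?add0r => [|i _]; last by rewrite partial_cst p0.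
by rewrite big1// => i _; rewrite !mxE partial_cst mulr0.
Qed.

Lemma dotDr (x y1 y2 : 'cV[R]_N) : dot x (y1 + y2) = dot x y1 + dot x y2.
Proof.
by rewrite /dot -big_split; apply: eq_bigr => i _; rewrite mxE mulrDr.
Qed.

Lemma dotZr (x y : 'cV[R]_N) (c : R) : dot x (c *: y) = c * dot x y.
Proof.
by rewrite /dot mulr_sumr; apply: eq_bigr => i _; rewrite mxE mulrCA.
Qed.

Lemma evolution_opD f g z : C21 f -> C21 g -> L (f + g) z = L f z + L g z.
Proof.
move=> cf cg.
have lapD : laplacian_x (f + g) z = laplacian_x f z + laplacian_x g z.
  rewrite /laplacian_x -big_split; apply: eq_bigr => i _ /=.
  have p2 : partial (Some i) (partial (Some i) f + partial (Some i) g) =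
    partial (Some i) (partial (Some i) f) + partial (Some i) (partial (Some i) g).
    by apply: partialE => y; apply: is_deriveD; exact: C21_is_derive2.
  by rewrite (partialD _ cf cg) p2.
have gradD : gradient_x (f + g) z = gradient_x f z + gradient_x g z.
  by apply/colP => i; rewrite !mxE partialD.
rewrite /evolution_op lapD gradD dotDr partialD//.
rewrite addrfctE; move: (laplacian_x f z) (laplacian_x g z)
  (dot _ (gradient_x f z)) (dot _ (gradient_x g z)) (partial _ _ z) (partial _ _ z).
by move=> *; ring.
Qed.

Lemma evolution_op_sum n (f : 'I_n -> V -> R) z :
  (forall k, C21 (f k)) -> L (\sum_k f k) z = \sum_k L (f k) z.
Proof.
move=> cf; suff [] : C21 (\sum_k f k) /\ L (\sum_k f k) z = \sum_k L (f k) z by [].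
elim/big_ind2 : _ => [|f1 x1 f2 x2 [c1 E1] [c2 E2]|k _].
- by split; [exact: C21_cst|exact: evolution_op_cst].
- by split; [exact: C21D|rewrite evolution_opD// E1 E2].
- by [].
Qed.

Lemma gradient_xM f g z : C21 f -> C21 g ->
  gradient_x (f * g) z = f z *: gradient_x g z + g z *: gradient_x f z.
Proof. by move=> cf cg; apply/colP => i; rewrite !mxE partialM. Qed.

(** A second-order operator fails to be a derivation by its carre du champ, here
    twice the product of the gradients. *)
Lemma evolution_opM f g z : C21 f -> C21 g ->
  L (f * g) z = f z * L g z + g z * L f z +
    dot (gradient_x f z) (gradient_x g z) *+ 2.
Proof.
move=> cf cg.
have lapM : laplacian_x (f * g) z = f z * laplacian_x g z +
    g z * laplacian_x f z + dot (gradient_x f z) (gradient_x g z) *+ 2.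
  rewrite /laplacian_x /dot !mulr_sumr -sumrMnl -!big_split.
  apply: eq_bigr => i _ /=; rewrite !mxE (partialM _ cf cg).
  by rewrite (partialE (fun y => is_derive2M i y cf cg)).
rewrite /evolution_op lapM gradient_xM// dotDr !dotZr partialM//.
rewrite addrfctE !mulrfctE; move: (f z) (g z) (laplacian_x f z) (laplacian_x g z)
  (dot _ (gradient_x f z)) (dot _ (gradient_x g z)) (dot _ _)
  (partial _ _ z) (partial _ _ z).
by move=> *; ring.
Qed.

Lemma evolution_op_time a d z : (forall t : R, is_derive t 1 a (d t)) ->
  L (a \o snd) z = - d z.2.
Proof.
move=> da; have p i : partial (Some i) (a \o snd : V -> R) = cst 0.
  exact: partial_time da.
rewrite /evolution_op /laplacian_x /dot big1 ?add0r => [|i _]; last first.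
  by rewrite p partial_cst.
rewrite big1 ?add0r => [|i _]; last by rewrite [in X in _ * X]mxE p mulr0.
by rewrite (partial_time None da).
Qed.

Lemma evolution_op_coord l z : L (fun z : V => z.1 l 0) z = (B *m z.1) l 0.
Proof.
rewrite /evolution_op /laplacian_x big1 => [|i _]; last first.
  by rewrite partial_coord partial_cst.
rewrite partial_coord subr0 add0r /dot (bigD1 l)//= big1 => [|i il].
  by rewrite [in X in _ * X]mxE partial_coord eqxx addr0 mulr1.
by rewrite [in X in _ * X]mxE partial_coord (negbTE il) mulr0.
Qed.

End ParabolicFunctions.

(** * Smooth solutions *)

Section SmoothSolutions.
Variables (R : realType) (N : nat) (B : 'M[R]_N).
Local Notation V := ('cV[R]_N * R)%type.
Implicit Types (u f : V -> R) (z : V) (j l : option 'I_N) (i : 'I_N).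

Lemma smooth_partial j u : smooth u -> smooth (partial j u).
Proof. by move=> su k; have [_ /(_ j) []] := su k.+1. Qed.

Lemma smooth_continuous u : smooth u -> continuous u.
Proof. by move=> su; have [] := su 0%N. Qed.

Lemma smooth_is_derive j u z : smooth u ->
  is_derive z (std_basis R j) u (partial j u z).
Proof. by move=> su; have [_ /(_ j) [du _]] := su 1%N; exact/derivableP. Qed.

Lemma smooth_C21 u : smooth u -> C21 u.
Proof.
move=> su; split=> [|j z|i z]; first exact: smooth_continuous.
- by have [] := smooth_is_derive j z su.
- by have [] := smooth_is_derive (Some i) z (smooth_partial (Some i) su).
Qed.

Lemma partial_comm j l u : smooth u ->
  partial j (partial l u) = partial l (partial j u).
Proof.
move=> su; apply/funext => z.
have sj := smooth_partial j su; have sl := smooth_partial l su.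
apply: (@derive_comm _ _ u (partial l u) (partial j u) _ _ _
  (std_basis R l) (std_basis R j)) => [y|y|y|y||].
- exact: smooth_is_derive.
- exact: smooth_is_derive.
- exact: smooth_is_derive.
- exact: smooth_is_derive.
- exact: (smooth_continuous (smooth_partial _ sl)).
- exact: (smooth_continuous (smooth_partial _ sj)).
Qed.

Lemma is_derive_drift i k z :
  is_derive z (std_basis R (Some i)) (fun z : V => (B *m z.1) k 0) (B k i).
Proof.
apply: line_is_derive => /=.
have -> : (fun r : R => (B *m (r *: delta_mx i 0 + z.1)) k 0) =
          (id : R -> R) * cst (B k i) + cst ((B *m z.1) k 0).
  apply/funext => r; rewrite mulmxDr -scalemxAr -colE [LHS]mxE.
  by rewrite [X in X + _]mxE [col _ _ _ _]mxE.
apply: is_derive_eq; rewrite scaler0 add0r addr0; exact: mulr1.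
Qed.

(** The equation is differentiated in the direction [x_i]; only the drift has
    variable coefficients, and it contributes the commutator [B^T grad u]. *)
Lemma evolution_op_partial u i z : smooth u ->
  (forall y, evolution_op B u y = 0) ->
  evolution_op B (partial (Some i) u) z = - \sum_k B k i * partial (Some k) u z.
Proof.
move=> su Lu.
have d0 : is_derive z (std_basis R (Some i)) (evolution_op B u) 0.
  have -> : evolution_op B u = cst 0 by exact/funext.
  exact: is_derive_cst.
have E : evolution_op B u =
    \sum_k partial (Some k) (partial (Some k) u) +
    \sum_k ((fun z : V => (B *m z.1) k 0) * partial (Some k) u) -
    partial None u.
  apply/funext => y; rewrite /evolution_op /laplacian_x /dot.
  rewrite -[RHS]/((\sum_k partial (Some k) (partial (Some k) u)) y +
   (\sum_k ((fun z : V => (B *m z.1) k 0) * partial (Some k) u)) y - partial None u y).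
  rewrite !fct_sumE; congr (_ + _ - _); apply: eq_bigr => k _.
  by rewrite [gradient_x _ _ _ _]mxE.
have d1 : is_derive z (std_basis R (Some i)) (evolution_op B u)
   (\sum_k partial (Some k) (partial (Some k) (partial (Some i) u)) z +
    \sum_k ((B *m z.1) k 0 * partial (Some k) (partial (Some i) u) z +
            partial (Some k) u z * B k i) -
    partial None (partial (Some i) u) z).
  have h1 : is_derive z (std_basis R (Some i))
      (\sum_k partial (Some k) (partial (Some k) u))
      (\sum_k partial (Some k) (partial (Some k) (partial (Some i) u)) z).
    apply: is_derive_sum => k.
    have -> : partial (Some k) (partial (Some k) (partial (Some i) u)) z =
              partial (Some i) (partial (Some k) (partial (Some k) u)) z.
      transitivity (partial (Some k) (partial (Some i) (partial (Some k) u)) z).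
        exact: (congr1 (fun f => partial (Some k) f z)
          (partial_comm (Some k) (Some i) su)).
      exact: (congr1 (@^~ z)
        (partial_comm (Some k) (Some i) (smooth_partial (Some k) su))).
    by apply: smooth_is_derive; do 2!apply: smooth_partial.
  have h2 : is_derive z (std_basis R (Some i))
      (\sum_k ((fun z : V => (B *m z.1) k 0) * partial (Some k) u))
      (\sum_k ((B *m z.1) k 0 * partial (Some k) (partial (Some i) u) z +
            partial (Some k) u z * B k i)).
    apply: is_derive_sum => k.
    have dk : is_derive z (std_basis R (Some i)) (partial (Some k) u)
        (partial (Some k) (partial (Some i) u) z).
      rewrite (partial_comm (Some k) (Some i) su).
      by apply: smooth_is_derive; apply: smooth_partial.
    exact: is_deriveM (is_derive_drift i k z) dk.
  have h3 : is_derive z (std_basis R (Some i)) (partial None u)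
      (partial None (partial (Some i) u) z).
    rewrite (partial_comm None (Some i) su).
    by apply: smooth_is_derive; apply: smooth_partial.
  rewrite E; exact: is_deriveB (is_deriveD h1 h2) h3.
have : 'D_(std_basis R (Some i)) (evolution_op B u) z = 0 by case: d0.
have [_ ->] := d1; rewrite big_split/= => H.
rewrite /evolution_op /laplacian_x /dot.
under [X in _ + X - _]eq_bigr do rewrite [in X in _ * X]mxE.
under [X in _ = - X]eq_bigr do rewrite mulrC.
apply/eqP; rewrite -addr_eq0; apply/eqP; apply: etrans H.
by rewrite [in RHS]addrA [RHS]addrAC.
Qed.

End SmoothSolutions.

(** * Functions carried by the flow *)

Section FlowFunctions.
Variables (R : realType) (N : nat) (B : 'M[R]_N).
Local Notation V := ('cV[R]_N * R)%type.
Local Notation E t := (expmx (t *: B)).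
Local Notation L := (evolution_op B).
Implicit Types (z : V) (i k : 'I_N).

Lemma is_derive_flow k l (t : R) :
  is_derive t 1 (fun t : R => E t k l) ((B *m E t) k l).
Proof.
have := is_derive_expmx B 1%:M k l t.
by under eq_fun do rewrite mul1mx; rewrite mul1mx.
Qed.

(** The coordinates of [y = E(t) x], in which the drift disappears. *)
Definition flow_coord k z : R := (E z.2 *m z.1) k 0.

Let flow_coordE k : flow_coord k =
  \sum_l ((fun t : R => E t k l) \o snd) * (fun z : V => z.1 l 0).
Proof. by apply/funext => z; rewrite /flow_coord mxE fct_sumE. Qed.

Let C21_entry k l : C21 ((fun t : R => E t k l) \o snd : V -> R).
Proof. exact: C21_time (is_derive_flow k l). Qed.

Lemma C21_flow_coord k : C21 (flow_coord k).
Proof.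
rewrite flow_coordE; apply: C21_sum => l; apply: C21M; last exact: C21_coord.
exact: C21_entry.
Qed.

Lemma partial_flow_coord k i z : partial (Some i) (flow_coord k) z = E z.2 k i.
Proof.
rewrite /partial flow_coordE.
have dl l : is_derive z (std_basis R (Some i))
   (((fun t : R => E t k l) \o snd) * (fun z : V => z.1 l 0))
   (E z.2 k l * (i == l)%:R).
  have h1 := is_derive_time (Some i) (is_derive_flow k l z.2).
  have h2 := is_derive_coord l (Some i) z.
  apply: is_derive_eq (is_deriveM h1 h2) _.
  by rewrite !scale_regE mulr0 addr0.
have [_ ->] := is_derive_sum dl.
rewrite (bigD1 i)//= eqxx mulr1 big1 ?addr0// => l li.
by rewrite eq_sym (negbTE li) mulr0.
Qed.

(** A linear function of [x] has no Laplacian; the drift contributes [E B x] and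
    the time derivative [B E x], which agree because [E] commutes with [B]. *)
Lemma evolution_op_flow_coord k z : L (flow_coord k) z = 0.
Proof.
rewrite flow_coordE evolution_op_sum => [|l]; last first.
  by apply: C21M; [exact: C21_entry|exact: C21_coord].
have Ll l : L (((fun t : R => E t k l) \o snd) * (fun z : V => z.1 l 0)) z =
    E z.2 k l * (B *m z.1) l 0 - (B *m E z.2) k l * z.1 l 0.
  rewrite evolution_opM; [|exact: C21_entry|exact: C21_coord].
  rewrite evolution_op_coord (evolution_op_time _ _ (is_derive_flow k l)).
  rewrite /dot big1 ?mul0rn ?addr0 => [|i _]; first by rewrite mulrN [in X in _ - X]mulrC.
  by rewrite mxE (partial_time _ (is_derive_flow k l)) mul0r.
under eq_bigr do rewrite Ll.
rewrite sumrB.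
have -> : \sum_l E z.2 k l * (B *m z.1) l 0 = (E z.2 *m (B *m z.1)) k 0.
  by rewrite [RHS]mxE.
have -> : \sum_l (B *m E z.2) k l * z.1 l 0 = (B *m E z.2 *m z.1) k 0.
  by rewrite [RHS]mxE.
by rewrite (expmx_comm B z.2) mulmxA subrr.
Qed.

Definition flow_sqnorm z : R := \sum_k flow_coord k z * flow_coord k z.

Let flow_sqnormE : flow_sqnorm = \sum_k flow_coord k * flow_coord k.
Proof. by apply/funext => z; rewrite fct_sumE. Qed.

Lemma C21_flow_sqnorm : C21 flow_sqnorm.
Proof.
by rewrite flow_sqnormE; apply: C21_sum => k; apply: C21M; exact: C21_flow_coord.
Qed.

Lemma partial_flow_sqnorm i z :
  partial (Some i) flow_sqnorm z = (\sum_k flow_coord k z * E z.2 k i) *+ 2.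
Proof.
rewrite /partial flow_sqnormE.
have dk k : is_derive z (std_basis R (Some i)) (flow_coord k * flow_coord k)
    (flow_coord k z * E z.2 k i *+ 2).
  have h := C21_is_derive (Some i) z (C21_flow_coord k).
  apply: is_derive_eq (is_deriveM h h) _.
  by rewrite !scale_regE partial_flow_coord -mulr2n.
by have [_ ->] := is_derive_sum dk; rewrite -sumrMnl.
Qed.

Lemma evolution_op_flow_sqnorm z :
  L flow_sqnorm z = (\sum_k \sum_i E z.2 k i ^+ 2) *+ 2.
Proof.
rewrite flow_sqnormE evolution_op_sum => [|k]; last by apply: C21M; exact: C21_flow_coord.
rewrite -sumrMnl; apply: eq_bigr => k _.
rewrite evolution_opM; [|exact: C21_flow_coord|exact: C21_flow_coord].
rewrite evolution_op_flow_coord mulr0 !add0r /dot; congr (_ *+ 2).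
by apply: eq_bigr => i _; rewrite !mxE partial_flow_coord expr2.
Qed.

(** The derivative of [u] in the direction [p(t) = E(-t) e], which solves
    [p' = - B p]. *)
Definition transported_derivative (u : V -> R) (e : 'cV[R]_N) z : R :=
  \sum_i (E (- z.2) *m e) i 0 * partial (Some i) u z.

Let is_derive_direction (e : 'cV[R]_N) i (t : R) :
  is_derive t 1 (fun t : R => (E (- t) *m e) i 0)
    (- (B *m (E (- t) *m e)) i 0).
Proof.
have dk k (s : R^o) : is_derive s 1 ((fun t : R => E (- t) i k) * cst (e k 0))
    ((- (B *m E (- s)) i k) * e k 0).
  have h1 : is_derive s 1 (fun t : R => E (- t) i k) (- (B *m E (- s)) i k).
    have := is_derive_expmx (- B) 1%:M i k s.
    under eq_fun do rewrite mul1mx scalerN -scaleNr.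
    by rewrite mul1mx scalerN -scaleNr mulNmx [in X in is_derive _ _ _ X -> _]mxE.
  apply: is_derive_eq (is_deriveM h1 (is_derive_cst (e k 0) s (1 : R^o))) _.
  by rewrite !scale_regE mulr0 add0r mulrC.
have -> : (fun t : R => (E (- t) *m e) i 0) =
    \sum_k ((fun t : R => E (- t) i k) * cst (e k 0)).
  by apply/funext => s; rewrite mxE fct_sumE.
apply: is_derive_eq (is_derive_sum (fun k => dk k t)) _.
rewrite mulmxA [in RHS]mxE -sumrN; apply: eq_bigr => k _.
by rewrite mulNr.
Qed.

Let transported_derivativeE u e : transported_derivative u e =
  \sum_i ((fun t : R => (E (- t) *m e) i 0) \o snd) * partial (Some i) u.
Proof. by apply/funext => z; rewrite fct_sumE. Qed.

Let C21_direction (e : 'cV[R]_N) i :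
  C21 ((fun t : R => (E (- t) *m e) i 0) \o snd : V -> R).
Proof. exact: C21_time (is_derive_direction e i). Qed.

Lemma C21_transported_derivative u e : smooth u ->
  C21 (transported_derivative u e).
Proof.
move=> su; rewrite transported_derivativeE; apply: C21_sum => i; apply: C21M.
  exact: C21_direction.
exact/smooth_C21/smooth_partial.
Qed.

(** The commutator [- B^T grad u] from [evolution_op_partial], paired with the
    direction [p], cancels the term coming from [p' = - B p]. *)
Lemma evolution_op_transported_derivative u e z : smooth u ->
  (forall y, L u y = 0) -> L (transported_derivative u e) z = 0.
Proof.
move=> su Lu; rewrite transported_derivativeE evolution_op_sum => [|i]; last first.
  by apply: C21M; [exact: C21_direction|exact/smooth_C21/smooth_partial].
have Li i : L (((fun t : R => (E (- t) *m e) i 0) \o snd) * partial (Some i) u) z =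
   \sum_k (B i k * (E (- z.2) *m e) k 0 * partial (Some i) u z) -
   \sum_k (B k i * (E (- z.2) *m e) i 0 * partial (Some k) u z).
  rewrite evolution_opM; [|exact: C21_direction|exact/smooth_C21/smooth_partial].
  rewrite evolution_op_partial// (evolution_op_time _ _ (is_derive_direction e i)).
  rewrite opprK [dot _ _]big1 ?mul0rn ?addr0 => [|k _]; last first.
    by rewrite mxE (partial_time _ (is_derive_direction e i)) mul0r.
  rewrite addrC mulrN; congr (_ - _).
    rewrite mxE mulr_sumr; apply: eq_bigr => k _; exact: mulrC.
  by rewrite mulr_sumr; apply: eq_bigr => k _; rewrite mulrCA mulrA.
under eq_bigr do rewrite Li.
by rewrite sumrB [X in _ - X]exchange_big subrr.
Qed.

End FlowFunctions.

(** * The weak maximum principle *)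

Section WeakMaximumPrinciple.
Variables (R : realType) (N : nat) (B : 'M[R]_N).
Local Notation V := ('cV[R]_N * R)%type.
Local Notation L := (evolution_op B).
Implicit Types (F g : V -> R) (z : V).

(** Positivity of [g] at [c] keeps the nearby points of the coordinate lines, and of
    the past, inside the region, so that [c] is a maximum along each of them.
    The drift drops out because the spatial gradient vanishes. *)
Lemma evolution_op_le0_max F g t0 c : C21 F -> continuous g ->
  c.2 <= t0 -> 0 < g c ->
  (forall z, z.2 <= t0 -> 0 <= g z -> F z <= F c) -> L F c <= 0.
Proof.
move=> cF cg ct gc Fc.
have g_near (v : V) : \forall s \near (0 : R), 0 <= g (s *: v + c).
  have cgv : g (s *: v + c) @[s --> (0 : R)] --> g c.
    have {2}-> : c = (0 : R) *: v + c by rewrite scale0r add0r.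
    apply: continuous_comp; last exact: cg.
    by apply: cvgD; [apply: cvgZr_tmp; exact: cvg_id|exact: cvg_cst].
  by near do apply: ltW; exact: cvgr_gt cgv _ gc.
have space i : \forall s \near (0 : R), F (s *: std_basis R (Some i) + c) <= F c.
  apply: filterS (g_near (std_basis R (Some i))) => s gs; apply: Fc => //=.
  by rewrite scaler0 add0r.
have time : \forall s \near (0 : R), s < 0 -> F (s *: std_basis R None + c) <= F c.
  apply: filterS (g_near (std_basis R None)) => s gs s0; apply: Fc => //=.
  by rewrite scale_regE mulr1 (le_trans _ ct)// gerDr ltW.
have p0 i : partial (Some i) F c = 0.
  exact: derive_eq0_max (C21_is_derive (Some i) c cF) (space i).
have lap0 : laplacian_x F c <= 0.
  apply: sumr_le0 => i _.
  exact: derive2_le0_max (fun y => C21_is_derive (Some i) y cF)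
    (C21_is_derive2 i c cF) (space i).
have t_ge0 : 0 <= partial None F c.
  exact: derive_ge0_left (C21_is_derive None c cF) time.
rewrite /evolution_op /dot big1 ?addr0 => [|i _].
  by rewrite subr_le0 (le_trans lap0).
by rewrite [in X in _ * X]mxE p0 mulr0.
Unshelve. all: by end_near. Qed.

(** At a maximum over the region either [g = 0], where the bound is assumed, or the
    operator is nonpositive, which is excluded for values above [M].  On
    the part [t = t0] of the boundary, looking back in time suffices. *)
Lemma weak_maximum F g t0 M : C21 F -> continuous g ->
  compact [set z : V | z.2 <= t0 /\ 0 <= g z] ->
  (forall z, z.2 <= t0 -> g z = 0 -> F z <= M) ->
  (forall z, z.2 <= t0 -> 0 < g z -> M < F z -> 0 < L F z) ->
  forall z, z.2 <= t0 -> 0 <= g z -> F z <= M.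
Proof.
move=> cF cg cQ bd int z zt gz.
have [||c /set_mem/=[ct gc] Fc] := @compact_EVT_max V R F _ _ cQ.
- by exists z.
- by case: cF => cF _ _; exact: continuous_subspaceT.
have Fcle y : y.2 <= t0 -> 0 <= g y -> F y <= F c.
  by move=> yt gy; apply: Fc; rewrite inE.
apply: (le_trans (Fcle z zt gz)); rewrite leNgt; apply/negP => McF.
move: gc; rewrite le_eqVlt => /orP[/eqP gc0|gc].
  by have := bd c ct (esym gc0); rewrite leNgt McF.
have := evolution_op_le0_max cF cg ct gc Fcle.
by rewrite leNgt int.
Qed.

Lemma compact_box (r a b : R) :
  compact [set z : V | (forall i, z.1 i 0 \in `[- r, r]) /\ z.2 \in `[a, b]].
Proof.
have cbox : compact [set x : 'cV[R]_N | forall i, x i 0 \in `[- r, r]].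
  have := @rV_compact R N (fun _ => [set` `[- r, r]]) (fun _ => @segment_compact R _ _).
  set A := [set v | _] => cA.
  have -> : [set x : 'cV[R]_N | forall i, x i 0 \in `[- r, r]] =
            (fun v : 'rV[R]_N => v^T) @` A.
    apply/seteqP; split=> [x xr|_ [v vA <-] i]; last by rewrite mxE; exact: vA.
    by exists x^T; rewrite ?trmxK// => i /=; rewrite mxE; exact: xr.
  apply: continuous_compact cA; apply: continuous_subspaceT => v.
  apply: cvg_mx_entries => [|i j]; first exact: nbhs_filter.
  under eq_fun do rewrite mxE; rewrite mxE.
  exact: coord_continuous.
have -> : [set z : V | (forall i, z.1 i 0 \in `[- r, r]) /\ z.2 \in `[a, b]] =
   [set x : 'cV[R]_N | forall i, x i 0 \in `[- r, r]] `*` [set` `[a, b]].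
  by [].
by apply: compact_setX => //; exact: segment_compact.
Qed.

End WeakMaximumPrinciple.

(** * Cutoff and comparison constants *)

(** Cauchy-Schwarz against the constant vector, by [2 a b <= a^2 + b^2]. *)
Lemma sqr_sum_le (R : realType) n (a : 'I_n -> R) :
  (\sum_k a k) ^+ 2 <= n%:R * \sum_k a k ^+ 2.
Proof.
have -> : n%:R * \sum_k a k ^+ 2 =
    \sum_(j < n) \sum_(k < n) ((a j ^+ 2 + a k ^+ 2) / 2).
  have -> : \sum_(j < n) \sum_(k < n) ((a j ^+ 2 + a k ^+ 2) / 2) =
      \sum_(j < n) \sum_(k < n) (a j ^+ 2 / 2) +
      \sum_(j < n) \sum_(k < n) (a k ^+ 2 / 2).
    rewrite -big_split; apply: eq_bigr => j _; rewrite -big_split.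
    by apply: eq_bigr => k _; rewrite mulrDl.
  rewrite [X in _ + X]exchange_big /=.
  under [X in _ = X + _]eq_bigr do rewrite sumr_const card_ord.
  under [X in _ = _ + X]eq_bigr do rewrite sumr_const card_ord.
  rewrite -big_split mulr_sumr; apply: eq_bigr => k _ /=.
  by rewrite -mulrnDl -splitr mulr_natl.
rewrite expr2 mulr_suml; apply: ler_sum => j _.
rewrite mulr_sumr; apply: ler_sum => k _.
have := sqr_ge0 (a j - a k); rewrite sqrrB; lra.
Qed.

Lemma sqr_sumM_le (R : realType) n (a b : 'I_n -> R) (K : R) : (forall k, `|b k| <= K) ->
  (\sum_k a k * b k) ^+ 2 <= n%:R * K ^+ 2 * \sum_k a k ^+ 2.
Proof.
move=> bK; apply: le_trans (sqr_sum_le _) _.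
rewrite -mulrA ler_wpM2l// mulr_sumr; apply: ler_sum => k _.
rewrite exprMn mulrC ler_wpM2r ?sqr_ge0//.
rewrite -real_normK ?num_real// lerXn2r// ?nnegrE//.
exact: le_trans (normr_ge0 _) (bK k).
Qed.

Section BernsteinEstimate.
Variables (R : realType) (N : nat) (B : 'M[R]_N).
Local Notation V := ('cV[R]_N * R)%type.
Local Notation E t := (expmx (t *: B)).
Local Notation L := (evolution_op B).
Implicit Types (z : V) (i k : 'I_N).

Lemma dot_ge0 (x : 'cV[R]_N) : 0 <= dot x x.
Proof. by apply: sumr_ge0 => i _; rewrite -expr2 sqr_ge0. Qed.

Lemma dotC (x y : 'cV[R]_N) : dot x y = dot y x.
Proof. by apply: eq_bigr => i _; rewrite mulrC. Qed.

Lemma dotDl (x1 x2 y : 'cV[R]_N) : dot (x1 + x2) y = dot x1 y + dot x2 y.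
Proof. by rewrite dotC dotDr !(dotC y). Qed.

Lemma dotZl (x y : 'cV[R]_N) (c : R) : dot (c *: x) y = c * dot x y.
Proof. by rewrite dotC dotZr dotC. Qed.

(** The paraboloid [cutoff >= 0], [t <= t0] plays the role of a parabolic cylinder of
    squared radius [r] with top at time [t0]; its lateral and bottom boundaries
    are both the set [cutoff = 0]. *)
Definition cutoff (r t0 : R) : V -> R :=
  cst (r - t0) + ((id : R -> R) \o snd) + cst (- 1) * flow_sqnorm B.

Lemma cutoffE r t0 z : cutoff r t0 z = r - (t0 - z.2) - flow_sqnorm B z.
Proof. by rewrite /cutoff !fctE /=; move: (flow_sqnorm B z) => S; ring. Qed.

Let is_derive_idR (t : R) : is_derive t 1 (id : R -> R) (cst (1 : R) t).
Proof. exact: is_derive_id. Qed.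

Let C21_id_time : C21 ((id : R -> R) \o snd : V -> R).
Proof. exact: C21_time is_derive_idR. Qed.

Let C21_opp_flow : C21 (cst (- 1) * flow_sqnorm B : V -> R).
Proof. by apply: C21M; [exact: C21_cst|exact: C21_flow_sqnorm]. Qed.

Let C21_affine_time r t0 : C21 (cst (r - t0) + ((id : R -> R) \o snd) : V -> R).
Proof. by apply: C21D; [exact: C21_cst|exact: C21_id_time]. Qed.

Lemma C21_cutoff r t0 : C21 (cutoff r t0).
Proof. exact: C21D (C21_affine_time r t0) C21_opp_flow. Qed.

Lemma evolution_op_cutoff r t0 z :
  L (cutoff r t0) z = - 1 - L (flow_sqnorm B) z.
Proof.
rewrite /cutoff (evolution_opD _ _ (C21_affine_time r t0) C21_opp_flow).
rewrite (evolution_opD _ _ (C21_cst _ (r - t0)) C21_id_time).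
rewrite evolution_op_cst (evolution_op_time _ _ is_derive_idR).
rewrite evolution_opM; [|exact: C21_cst|exact: C21_flow_sqnorm].
rewrite evolution_op_cst mulr0 addr0 add0r mulN1r [dot _ _]big1 ?mul0rn ?addr0//.
by move=> i _; rewrite mxE partial_cst mul0r.
Qed.

Lemma partial_cutoff r t0 i z :
  partial (Some i) (cutoff r t0) z = - partial (Some i) (flow_sqnorm B) z.
Proof.
rewrite /cutoff (partialD _ (C21_affine_time r t0) C21_opp_flow).
rewrite (partialD _ (C21_cst _ (r - t0)) C21_id_time).
rewrite partialM; [|exact: C21_cst|exact: C21_flow_sqnorm].
rewrite !partial_cst (partial_time _ is_derive_idR) !fctE.
by rewrite /= mulN1r mulr0 !addr0 add0r.
Qed.

Variable K : R.
Hypothesis EK : forall t i j, `|E t i j| <= K.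

Lemma flow_sqnorm_ge0 z : 0 <= flow_sqnorm B z.
Proof. by apply: sumr_ge0 => k _; rewrite -expr2 sqr_ge0. Qed.

Lemma gradient_cutoff_le r t0 z :
  dot (gradient_x (cutoff r t0) z) (gradient_x (cutoff r t0) z) <=
  4 * N%:R ^+ 2 * K ^+ 2 * flow_sqnorm B z.
Proof.
apply: (@le_trans _ _ (\sum_(i < N) 4 * (N%:R * K ^+ 2 * flow_sqnorm B z))).
  apply: ler_sum => i _; rewrite !mxE partial_cutoff partial_flow_sqnorm.
  have := sqr_sumM_le (fun k => flow_coord B k z) (fun k => EK z.2 k i).
  rewrite /flow_sqnorm; under [X in _ <= _ * _ * X]eq_bigr do rewrite expr2.
  rewrite -mulr_natr -/(flow_sqnorm B z); move: (\sum_k _) (flow_sqnorm B z) => h S.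
  move=> hS; rewrite mulrNN; lra.
by rewrite sumr_const card_ord -mulr_natl le_eqVlt; apply/orP; left; apply/eqP; ring.
Qed.

Lemma evolution_op_flow_sqnorm_le z :
  L (flow_sqnorm B) z <= 2 * (N%:R ^+ 2 * K ^+ 2).
Proof.
rewrite evolution_op_flow_sqnorm -mulr_natl ler_wpM2l//.
apply: (@le_trans _ _ (\sum_(k < N) \sum_(i < N) K ^+ 2)).
  apply: ler_sum => k _; apply: ler_sum => i _.
  rewrite -real_normK ?num_real// lerXn2r// ?nnegrE//.
  exact: le_trans (normr_ge0 _) (EK 0 k i).
by rewrite !sumr_const card_ord -mulrnA -[leLHS]mulr_natl natrM expr2.
Qed.

(** The flow is inverted by [E(-t)], whose entries are bounded too. *)
Lemma space_le_flow_sqnorm z i :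
  z.1 i 0 ^+ 2 <= N%:R * K ^+ 2 * flow_sqnorm B z.
Proof.
have -> : z.1 i 0 = \sum_k flow_coord B k z * E (- z.2) i k.
  have -> : z.1 = E (- z.2) *m (E z.2 *m z.1).
    by rewrite mulmxA -{2}[z.2]opprK expmxMN mul1mx.
  by rewrite mxE; apply: eq_bigr => k _; rewrite mulrC.
have := sqr_sumM_le (fun k => flow_coord B k z) (fun k => EK (- z.2) i k).
by rewrite /flow_sqnorm; under [X in _ <= _ * _ * X]eq_bigr do rewrite expr2.
Qed.

(** The region is closed, and the flow bounds confine it to a box. *)
Lemma compact_cutoff r t0 :
  compact [set z : V | z.2 <= t0 /\ 0 <= cutoff r t0 z].
Proof.
have [cg _ _] := C21_cutoff r t0.
set rho := N%:R * K ^+ 2 * r + 1.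
apply: (@subclosed_compact _ _ _ _ (@compact_box R N rho (t0 - r) t0)).
- apply: closedI.
    have := @closed_comp _ _ (snd : V -> R) [set t | t <= t0].
    by apply; [move=> z _; exact: cvg_snd|exact: closed_le].
  have := @closed_comp _ _ (cutoff r t0) [set t | 0 <= t].
  by apply; [move=> z _; exact: cg|exact: closed_ge].
- move=> z /= [zt]; rewrite cutoffE => gz; have S0 := flow_sqnorm_ge0 z.
  split=> [i|]; last by rewrite in_itv/= zt andbT; lra.
  have := space_le_flow_sqnorm z i.
  have : N%:R * K ^+ 2 * flow_sqnorm B z <= N%:R * K ^+ 2 * r.
    have NK : 0 <= N%:R * K ^+ 2 by rewrite mulr_ge0// sqr_ge0.
    by rewrite ler_wpM2l//; lra.
  rewrite in_itv/= /rho; move: (_ * r) (_ * flow_sqnorm B z) (z.1 i 0) => a b x h1 h2.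
  by apply/andP; split; nra.
Qed.

(** The direction [E(-t) e] stays bounded for all times. *)
Lemma transported_derivative_le (u : V -> R) e z :
  transported_derivative B u e z ^+ 2 <=
  N%:R * (K * \sum_k `|e k 0|) ^+ 2 * dot (gradient_x u z) (gradient_x u z).
Proof.
have pK i : `|(E (- z.2) *m e) i 0| <= K * \sum_k `|e k 0|.
  rewrite mxE (le_trans (ler_norm_sum _ _ _))// mulr_sumr; apply: ler_sum => k _.
  by rewrite normrM ler_wpM2r.
have := sqr_sumM_le (fun k => partial (Some k) u z) pK.
rewrite /transported_derivative /dot.
under [X in X ^+ 2 <= _ -> _]eq_bigr do rewrite mulrC.
by under [X in _ -> _ <= _ * _ * X]eq_bigr do rewrite !mxE -expr2.
Qed.

End BernsteinEstimate.

(** * The gradient estimate and the Liouville property *)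

Section Liouville.
Variables (R : realType) (N : nat) (B : 'M[R]_N).
Local Notation V := ('cV[R]_N * R)%type.
Local Notation E t := (expmx (t *: B)).
Local Notation L := (evolution_op B).
Implicit Types (u g w : V -> R) (z : V) (e : 'cV[R]_N).

Definition bernstein_function (lam : R) g w u : V -> R :=
  (g * w) * (g * w) + cst lam * (u * u).

Lemma C21_bernstein_function lam g w u : C21 g -> C21 w -> C21 u ->
  C21 (bernstein_function lam g w u).
Proof.
move=> cg cw cu; apply: C21D; first by apply: C21M; exact: C21M.
by apply: C21M; [exact: C21_cst|exact: C21M].
Qed.

(** The cross term [8 g w <grad g, grad w>] is absorbed by [2 g^2 |grad w|^2] at the
    cost of [8 w^2 |grad g|^2]: the defect is twice the square of
    [g grad w + 2 w grad g]. *)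
Lemma evolution_op_bernstein_ge lam g w u z : C21 g -> C21 w -> C21 u ->
  L w z = 0 -> L u z = 0 ->
  2 * g z * w z ^+ 2 * L g z -
  6 * w z ^+ 2 * dot (gradient_x g z) (gradient_x g z) +
  2 * lam * dot (gradient_x u z) (gradient_x u z) <=
  L (bernstein_function lam g w u) z.
Proof.
move=> cg cw cu Lw Lu.
have cgw := C21M cg cw; have cuu := C21M cu cu.
rewrite /bernstein_function.
rewrite (evolution_opD B z (C21M cgw cgw) (C21M (C21_cst _ lam) cuu)).
rewrite (evolution_opM B z cgw cgw) (evolution_opM B z cg cw).
rewrite (evolution_opM B z (C21_cst _ lam) cuu) (evolution_opM B z cu cu).
rewrite evolution_op_cst Lw Lu (gradient_xM z cg cw).
have -> : gradient_x (cst lam : V -> R) z = 0.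
  by apply/colP => i; rewrite !mxE partial_cst.
rewrite !mulrfctE /cst.
have dot0l (x : 'cV[R]_N) : dot 0 x = 0.
  by rewrite /dot big1// => i _; rewrite mxE mul0r.
rewrite dot0l.
move: (gradient_x g z) (gradient_x w z) (gradient_x u z) => G W U.
have := dot_ge0 (g z *: W + (2 * w z) *: G).
rewrite !dotDr !dotDl !dotZr !dotZl (dotC G W).
move: (dot W W) (dot W G) (dot G G) (dot U U) (L g z) (g z) (w z) (u z).
move=> a b c d l x y v H.
rewrite -subr_ge0; apply: le_trans (mulr_ge0 (ler0n R 2) H) _.
by rewrite le_eqVlt; apply/orP; left; apply/eqP; ring.
Qed.

Variable K : R.
Hypothesis EK : forall t i j, `|E t i j| <= K.

(** The constant does not depend on [r]: this decay rate is what yields the Liouville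
    property.  The cutoff has its top at the time of the point considered. *)
Lemma transported_derivative_estimate u (M : R) e : smooth u ->
  (forall z, L u z = 0) -> (forall z, `|u z| <= M) ->
  exists C : R, forall (r : R) z, 0 < r -> 2 * flow_sqnorm B z <= r ->
    r * transported_derivative B u e z ^+ 2 <= C.
Proof.
move=> su Lu uM.
set C1 := 1 + 2 * (N%:R ^+ 2 * K ^+ 2).
set C2 := 4 * N%:R ^+ 2 * K ^+ 2.
set C4 := N%:R * (K * \sum_k `|e k 0|) ^+ 2.
exists (4 * (C4 * (2 * C1 + 6 * C2)) * M ^+ 2) => r z0 r0 Sr.
set w := transported_derivative B u e.
set g := cutoff B r z0.2.
(* [C4] converts [|grad u|^2] into [w^2], and [r * (2 * C1 + 6 * C2)] then dominates
   the two negative terms of [evolution_op_bernstein_ge]. *)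
set lam := r * (C4 * (2 * C1 + 6 * C2)).
have C1_ge1 : 1 <= C1.
  by rewrite lerDl; exact: mulr_ge0 (ler0n R 2) (mulr_ge0 (sqr_ge0 _) (sqr_ge0 _)).
have C2_ge0 : 0 <= C2.
  exact: mulr_ge0 (mulr_ge0 (ler0n R 4) (sqr_ge0 _)) (sqr_ge0 _).
have C4_ge0 : 0 <= C4 by rewrite mulr_ge0// sqr_ge0.
have A_gt0 : 0 < 2 * C1 + 6 * C2 by lra.
have lam_ge0 : 0 <= lam.
  exact: mulr_ge0 (ltW r0) (mulr_ge0 C4_ge0 (ltW A_gt0)).
have cu := smooth_C21 su.
have cw : C21 w := C21_transported_derivative B e su.
have cg : C21 g := C21_cutoff B r z0.2.
have u2M z : u z ^+ 2 <= M ^+ 2.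
  rewrite -real_normK ?num_real// lerXn2r// ?nnegrE//.
  exact: le_trans (normr_ge0 _) (uM z).
have FE z : bernstein_function lam g w u z = g z ^+ 2 * w z ^+ 2 + lam * u z ^+ 2.
  by rewrite /bernstein_function !fctE /= -!expr2 exprMn.
have small z : g z * w z = 0 -> bernstein_function lam g w u z <= lam * M ^+ 2.
  by move=> gw0; rewrite FE -exprMn gw0 expr0n add0r ler_wpM2l.
have gz0 : r / 2 <= g z0 by rewrite /g cutoffE subrr; lra.
have : bernstein_function lam g w u z0 <= lam * M ^+ 2.
  apply: (@weak_maximum R N B _ g z0.2 _ (C21_bernstein_function lam cg cw cu)
    _ (@compact_cutoff _ _ _ _ EK r z0.2)) => //.
  - by case: cg.
  - by move=> z _ gz; apply: small; rewrite gz mul0r.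
  - move=> z zt gz ltF.
    have w0 : 0 < w z ^+ 2.
      rewrite lt_neqAle sqr_ge0 andbT eq_sym sqrf_eq0; apply/negP => /eqP w0.
      by move: ltF; rewrite ltNge small// w0 mulr0.
    have S0 := flow_sqnorm_ge0 B z.
    have Sle : flow_sqnorm B z <= r by move: gz zt; rewrite /g cutoffE; lra.
    have gr : g z <= r by move: zt; rewrite /g cutoffE; lra.
    have Lw : L w z = 0 by exact: evolution_op_transported_derivative.
    apply: lt_le_trans (evolution_op_bernstein_ge lam cg cw cu Lw (Lu z)).
    have Lg : - C1 <= L g z.
      rewrite /g evolution_op_cutoff /C1.
      by have := evolution_op_flow_sqnorm_le EK z; lra.
    have Dg : dot (gradient_x g z) (gradient_x g z) <= C2 * r.
      apply: le_trans (gradient_cutoff_le EK r z0.2 z) _.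
      by rewrite -/C2 ler_wpM2l.
    have Dw : w z ^+ 2 <= C4 * dot (gradient_x u z) (gradient_x u z).
      exact: transported_derivative_le.
    have gLg : - (r * C1) <= g z * L g z.
      apply: (@le_trans _ _ (g z * - C1)); last by rewrite ler_wpM2l// ltW.
      by rewrite mulrN lerN2 ler_wpM2r//; lra.
    have h1 := ler_wpM2l (ltW w0) gLg.
    have h2 := ler_wpM2l (ltW w0) Dg.
    have rC0 : 0 < r * (2 * C1 + 6 * C2) by exact: mulr_gt0.
    have h3 := ler_wpM2l (ltW rC0) Dw.
    have h4 := mulr_gt0 rC0 w0.
    rewrite /lam; move: h1 h2 h3 h4; clear.
    move: (dot (gradient_x u z) _) (dot _ _) (L g z) (w z ^+ 2) (g z).
    by move=> *; nra.
  - by apply: le_trans gz0; lra.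
rewrite FE => Fz0.
have h1 : (r / 2) ^+ 2 * w z0 ^+ 2 <= g z0 ^+ 2 * w z0 ^+ 2.
  by rewrite ler_wpM2r ?sqr_ge0// lerXn2r// nnegrE; lra.
have h2 : 0 <= lam * u z0 ^+ 2 by rewrite mulr_ge0// sqr_ge0.
rewrite -(ler_pM2l r0); rewrite /lam in Fz0 h2.
move: h1 h2 Fz0; clear; move: (w z0 ^+ 2) (u z0 ^+ 2) (g z0 ^+ 2) (M ^+ 2) (C4 * _).
by move=> a b c d l; nra.
Qed.

Lemma solution_constant u (M : R) : smooth u -> (forall z, L u z = 0) ->
  (forall z, `|u z| <= M) -> exists c, forall z, u z = c.
Proof.
move=> su Lu uM.
have w0 e z : transported_derivative B u e z = 0.
  have [C Cle] := transported_derivative_estimate e su Lu uM.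
  have S0 := flow_sqnorm_ge0 B z.
  apply/eqP; rewrite -sqrf_eq0; apply/eqP/le_anti; rewrite sqr_ge0 andbT leNgt.
  apply/negP => w0.
  (* Large enough for [r * w^2] to exceed [C]. *)
  set r := 2 * flow_sqnorm B z + 1 + `|C| / transported_derivative B u e z ^+ 2.
  have q0 : 0 <= `|C| / transported_derivative B u e z ^+ 2.
    by rewrite divr_ge0// ltW.
  have rE : r * transported_derivative B u e z ^+ 2 =
      (2 * flow_sqnorm B z + 1) * transported_derivative B u e z ^+ 2 + `|C|.
    by rewrite /r [LHS]mulrDl divfK// lt0r_neq0.
  have rC : r * transported_derivative B u e z ^+ 2 <= C.
    by apply: Cle; rewrite /r; lra.
  have : 0 < (2 * flow_sqnorm B z + 1) * transported_derivative B u e z ^+ 2.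
    by rewrite mulr_gt0//; lra.
  move: rC; rewrite rE.
  have := ler_norm C; lra.
have pi0 i z : partial (Some i) u z = 0.
  (* This choice of [e] makes the transported direction equal to [x_i] at [z]. *)
  rewrite -(w0 (E z.2 *m delta_mx i 0) z) /transported_derivative mulmxA.
  rewrite -{2}[z.2]opprK expmxMN mul1mx (bigD1 i)//= big1 ?addr0 => [|k ki].
    by rewrite mxE !eqxx mul1r.
  by rewrite mxE (negbTE ki) mul0r.
have pi0f i : partial (Some i) u = 0 by apply/funext => z; exact: pi0.
have pt0 z : partial None u z = 0.
  have := Lu z; rewrite /evolution_op /laplacian_x /dot.
  rewrite big1 => [|i _]; last by rewrite pi0f; exact: (congr1 (@^~ z) (partial_cst _ 0)).
  rewrite big1 => [|i _]; last by rewrite [in X in _ * X]mxE pi0 mulr0.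
  by rewrite add0r sub0r => /eqP; rewrite oppr_eq0 => /eqP.
have d0 j z : is_derive z (std_basis R j) u 0.
  have := smooth_is_derive j z su.
  by case: j => [i|]; rewrite ?pi0 ?pt0.
exists (u 0) => z.
have step j (s : R) y : u (s *: std_basis R j + y) = u y.
  exact: derive_eq0_line (d0 j).
have -> : z = \sum_i z.1 i 0 *: std_basis R (Some i) + (z.2 *: std_basis R None + 0).
  have -> : \sum_i z.1 i 0 *: std_basis R (Some i) = (z.1, 0).
    transitivity (\sum_i (z.1 i 0 *: delta_mx i 0 : 'cV[R]_N), 0 : R).
      elim/big_rec2 : _ => [//|i y1 y2 _ ->].
      by rewrite [LHS]surjective_pairing /= scaler0 addr0.
    by congr pair; rewrite [RHS]matrix_sum_delta; apply: eq_bigr => i _; rewrite big_ord1.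
  rewrite addr0; case: z => x t; congr pair => /=.
    by rewrite scaler0 addr0.
  by rewrite add0r; exact/esym/mulr1.
rewrite -(step None z.2 0); move: (_ *: _ + 0) => y.
elim/big_rec : _ => [|i x _ IH]; first by rewrite add0r.
by rewrite -addrA step.
Qed.

End Liouville.

Theorem theorem1p3 (R : realType) (N : nat) (B : 'M[R]_N)
  (hB : (ereal_sup
           (range (fun t : R => (operator_norm (expmx (- t *: B)))%:E))
         < +oo)%E)
  (u : 'cV[R]_N * R -> R)
  (u_bounded : bounded_fun u)
  (u_smooth : smooth u)
  (u_sol : forall z : 'cV[R]_N * R, evolution_op B u z = 0) :
  exists c : R, forall z : 'cV[R]_N * R, u z = c.
Proof.
have [K _ EK] := expmx_entry_bounded hB.
have [M [_ uM]] := u_bounded.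
apply: (solution_constant EK u_smooth u_sol (M := M + 1)) => z.
by apply: uM => //; rewrite ltrDl.
Qed.
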